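(* Let $\mathcal S$ be a linear time-invariant system $x_{t+1}=Ax_t+Bu_t$, $y_t=Cx_t+Du_t$ with $u_t\in\mathbb R^m$, $y_t\in\mathbb R^p$, $x_t\in\mathbb R^n$, which is controllable and observable (so that $n$ is the minimal state dimension), with $n,m,p$ known. Let $L$ be its maximal lag and let $\ell>L$. Suppose $j$ input-output records of $\mathcal S$, each contiguous of length $\ell$, are measured exactly, the $i$-th record being $\{(u_{t_i+t},y_{t_i+t}) : t=1,\dots,\ell\}$ with unknown initial state $x_{t_i+1}$, and let $\mathbb U_\ell\in\mathbb R^{\ell m\times j}$ and $\mathbb Y_\ell\in\mathbb R^{\ell p\times j}$ be the associated multi-record data matrices. If $$\operatorname{rank}\begin{bmatrix}\mathbb U_\ell\\ \mathbb Y_\ell\end{bmatrix}=m\ell+n\qquad\text{and}\qquad \operatorname{rank}\mathbb U_\ell=m\ell,$$ then the multiple-record subspace system identification algorithm applied to these data yields a minimal state-space description of $\mathcal S$ and all of the corresponding initial states; that is, for its output $(\hat A,\hat B,\hat C,\hat D,\hat x_{t_1+1},\dots,\hat x_{t_j+1})$ there is an invertible matrix $T\in\mathbb R^{n\times n}$ such that $$A=T\hat AT^{-1},\quad B=T\hat B,\quad C=\hat CT^{-1},\quad D=\hat D,\quad x_{t_i+1}=T\hat x_{t_i+1}\ \ (i=1,\dots,j).$$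
   Context: All matrices are real; $M^\dagger$ is the Moore-Penrose pseudoinverse, $\operatorname{vec}$ stacks columns, $\otimes$ is the Kronecker product. Maximal lag. With $w_t=\begin{bmatrix}u_t\\ y_t\end{bmatrix}$, the behavior $\mathfrak B$ of $\mathcal S$ is the set of all sequences $(w_t)_{t\ge1}$ for which there is a state sequence $(x_t)_{t\ge 1}$ satisfying the equations of $\mathcal S$ (arbitrary initial state $x_1$). Let $\sigma$ be the shift, $(\sigma w)_t=w_{t+1}$. There is a row-reduced polynomial matrix $R(\sigma)$ of size $p\times(p+m)$, of minimal degree and unique up to left multiplication by a unimodular polynomial matrix, with $\mathfrak B=\{w: R(\sigma)w=0\}$ (kernel representation). The maximal lag $L$ is the maximal degree of the entries of $R$. Data matrices. For each $i=1,\dots,j$, the $i$-th record is part of a trajectory of $\mathcal S$: there are states with $x_{t_i+t+1}=Ax_{t_i+t}+Bu_{t_i+t}$ and $y_{t_i+t}=Cx_{t_i+t}+Du_{t_i+t}$ for $t=1,\dots,\ell$. The $i$-th column of $\mathbb U_\ell$ is $(u_{t_i+1}^T,u_{t_i+2}^T,\dots,u_{t_i+\ell}^T)^T$ and the $i$-th column of $\mathbb Y_\ell$ is $(y_{t_i+1}^T,\dots,y_{t_i+\ell}^T)^T$. Records need not be contiguous with each other and may overlap. Multiple-record subspace system identification algorithm (input: $\mathbb U_\ell,\mathbb Y_\ell,n,m,p,\ell$). Step 1. Form $\Pi^\perp=I-\mathbb U_\ell^T(\mathbb U_\ell\mathbb U_\ell^T)^\dagger\mathbb U_\ell$ and the matrix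 $\mathbb Y_\ell\Pi^\perp$. Step 2. Compute a singular value decomposition $\mathbb Y_\ell\Pi^\perp=\begin{bmatrix}\mathbb Q_1&\mathbb Q_2\end{bmatrix}\begin{bmatrix}\mathbb S_1&0\\0&\mathbb S_2\end{bmatrix}\begin{bmatrix}\mathbb P_1^T\\ \mathbb P_2^T\end{bmatrix}$, where $\mathbb S_1$ is the $n\times n$ diagonal matrix of the $n$ largest singular values, and set $\hat\Gamma_\ell=\mathbb Q_1\mathbb S_1^{1/2}\in\mathbb R^{\ell p\times n}$. Step 3. Let $\hat C$ be the first $p$ rows of $\hat\Gamma_\ell$ and let $\hat A=\big(\hat\Gamma_\ell(1{:}(\ell-1)p,:)\big)^\dagger\,\hat\Gamma_\ell(p+1{:}\ell p,:)$, where $(a{:}b,:)$ denotes rows $a$ through $b$. Step 4. Consider the linear system, in the unknowns $B\in\mathbb R^{n\times m}$, $D\in\mathbb R^{p\times m}$ and $x_{t_1+1},\dots,x_{t_j+1}\in\mathbb R^n$, consisting of the equations $$y_{t_i+t}=\sum_{\tau=1}^{t-1}\hat C\hat A^{t-1-\tau}Bu_{t_i+\tau}+Du_{t_i+t}+\hat C\hat A^{t-1}x_{t_i+1},\qquad t=1,\dots,\ell,\ i=1,\dots,j.$$ Write it as $\operatorname{vec}(\mathbb Y_\ell)=\Upsilon\vartheta$ with $\vartheta=\big[\operatorname{vec}(B)^T\ \operatorname{vec}(D)^T\ x_{t_1+1}^T\ \cdots\ x_{t_j+1}^T\big]^T$; thus the block row of $\Upsilon$ indexed by $(i,t)$ is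 $\big[\sum_{\tau=1}^{t-1}u_{t_i+\tau}^T\otimes\hat C\hat A^{t-1-\tau},\ \ u_{t_i+t}^T\otimes I_p,\ \ 0,\dots,0,\ \hat C\hat A^{t-1},\ 0,\dots,0\big]$ with $\hat C\hat A^{t-1}$ in the position of $x_{t_i+1}$. Compute $\hat\vartheta=(\Upsilon^T\Upsilon)^\dagger\Upsilon^T\operatorname{vec}(\mathbb Y_\ell)$ and read off $\hat B,\hat D,\hat x_{t_1+1},\dots,\hat x_{t_j+1}$ from $\hat\vartheta$. Output: $(\hat A,\hat B,\hat C,\hat D,\hat x_{t_1+1},\dots,\hat x_{t_j+1})$. *)

(* Defs.v *)
From mathcomp Require Export all_boot all_order all_algebra reals.
From mathcomp.real_closed Require Export mxtens.
From mathcomp Require Import classical_sets.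

Set Implicit Arguments.
Unset Strict Implicit.
Unset Printing Implicit Defensive.

Import Order.TTheory GRing.Theory Num.Theory.
Local Open Scope ring_scope.

(* Time is 0-based: index t below stands for time t + 1 (time t_i + t + 1    *)
(* inside the i-th record).                                                  *)

Section Systems.
Variables (R : realType) (n m p : nat).
Variables (A : 'M[R]_n) (B : 'M[R]_(n, m)) (C : 'M[R]_(p, n)) (D : 'M[R]_(p, m)).

Definition system_eqs (u : nat -> 'cV[R]_m) (x : nat -> 'cV[R]_n)
    (y : nat -> 'cV[R]_p) (t : nat) : Prop :=
  x t.+1 = A *m x t + B *m u t /\ y t = C *m x t + D *m u t.

Definition controllable : Prop :=
  forall x0 x1 : 'cV[R]_n, exists (N : nat) (u : nat -> 'cV[R]_m)
    (x : nat -> 'cV[R]_n),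
    [/\ x 0%N = x0, forall t, x t.+1 = A *m x t + B *m u t & x N = x1].

Definition observable : Prop :=
  forall u x x' y, (forall t, system_eqs u x y t) ->
    (forall t, system_eqs u x' y t) -> x 0%N = x' 0%N.

Definition behavior (w : nat -> 'cV[R]_(m + p)) : Prop :=
  exists x, forall t,
    system_eqs (fun k => usubmx (w k)) x (fun k => dsubmx (w k)) t.

End Systems.

Section PolynomialMatrices.
Variables (R : realType) (p q : nat).
Implicit Types P : 'M[{poly R}]_(p, q).

(* The sequence P(sigma) w, for sigma the left shift. *)
Definition shift_act P (w : nat -> 'cV[R]_q) (t : nat) : 'cV[R]_p :=
  \col_i \sum_k \sum_(d < size (P i k)) (P i k)`_d * w (t + d)%N k 0.

Definition row_degree P (i : 'I_p) : nat := \max_(k < q) (size (P i k)).-1.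

Definition mx_degree P : nat := \max_(i < p) row_degree P i.

Definition row_reduced P : bool :=
  row_free (\matrix_(i, k) (P i k)`_(row_degree P i)).

End PolynomialMatrices.

Section MaximalLag.
Variables (R : realType) (n m p : nat).
Variables (A : 'M[R]_n) (B : 'M[R]_(n, m)) (C : 'M[R]_(p, n)) (D : 'M[R]_(p, m)).

Definition kernel_representation (P : 'M[{poly R}]_(p, m + p)) : Prop :=
  forall w, behavior A B C D w <-> forall t, shift_act P w t = 0.

Definition maximal_lag (L : nat) : Prop :=
  exists P, [/\ row_reduced P, kernel_representation P,
    forall P', kernel_representation P' -> (mx_degree P <= mx_degree P')%N
    & L = mx_degree P].

End MaximalLag.

Section Pseudoinverse.
Variable R : realType.

Definition penrose a b (M : 'M[R]_(a, b)) (X : 'M[R]_(b, a)) : Prop :=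
  [/\ M *m X *m M = M, X *m M *m X = X,
      (M *m X)^T = M *m X & (X *m M)^T = X *m M].

Definition pseudoinv a b (M : 'M[R]_(a, b)) : 'M[R]_(b, a) :=
  xget 0 [set X | penrose M X]%classic.

Lemma gram_unitmx a b (M : 'M[R]_(a, b)) : row_free M -> M *m M^T \in unitmx.
Proof.
move=> fM; rewrite -row_free_unit; apply: inj_row_free => v vMM0.
suff vM0 : v *m M = 0 by apply: (row_free_inj fM); rewrite vM0 mul0mx.
have /matrixP/(_ 0 0) : v *m M *m (v *m M)^T = 0.
  by rewrite trmx_mul mulmxA -(mulmxA v) vMM0 mul0mx.
rewrite mxE [RHS]mxE; under eq_bigr do rewrite [X in _ * X]mxE -expr2.
move=> /eqP; rewrite psumr_eq0 => [/allP s0|k _]; last exact: sqr_ge0.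
apply/rowP => k; rewrite [RHS]mxE; apply/eqP.
by have := s0 k (mem_index_enum k); rewrite /= sqrf_eq0.
Qed.

Lemma penrose_exists a b (M : 'M[R]_(a, b)) : exists X, penrose M X.
Proof.
have [r [F [G [MFG fF fG]]]] : exists r (F : 'M[R]_(a, r)) (G : 'M[R]_(r, b)),
    [/\ M = F *m G, row_full F & row_free G].
  by exists (\rank M), (col_base M), (row_base M); rewrite mulmx_base;
    split=> //; [exact: col_base_full | exact: row_base_free].
have uG : G *m G^T \in unitmx by exact: gram_unitmx.
have uF : F^T *m F \in unitmx.
  rewrite -{2}[F]trmxK; apply: gram_unitmx.
  by rewrite /row_free mxrank_tr; exact: fF.
have sG : (invmx (G *m G^T))^T = invmx (G *m G^T).
  by rewrite trmx_inv trmx_mul trmxK.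
have sF : (invmx (F^T *m F))^T = invmx (F^T *m F).
  by rewrite trmx_inv trmx_mul trmxK.
pose X := G^T *m invmx (G *m G^T) *m (invmx (F^T *m F) *m F^T).
have MX : M *m X = F *m invmx (F^T *m F) *m F^T.
  rewrite MFG /X -!mulmxA (mulmxA G G^T) (mulmxA (G *m G^T)) mulmxV //.
  by rewrite mul1mx.
have XM : X *m M = G^T *m invmx (G *m G^T) *m G.
  rewrite MFG /X -!mulmxA (mulmxA F^T F) (mulmxA (invmx (F^T *m F))) mulVmx //.
  by rewrite mul1mx.
exists X; split.
- rewrite MX MFG -!mulmxA (mulmxA F^T F) (mulmxA (invmx (F^T *m F))).
  by rewrite mulVmx // mul1mx.
- rewrite XM /X -!mulmxA (mulmxA G G^T) (mulmxA (G *m G^T)) mulmxV //.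
  by rewrite mul1mx.
- by rewrite MX !trmx_mul trmxK sF mulmxA.
- by rewrite XM !trmx_mul trmxK sG mulmxA.
Qed.

Lemma pseudoinvP a b (M : 'M[R]_(a, b)) : penrose M (pseudoinv M).
Proof. exact: xgetPex (penrose_exists M). Qed.

End Pseudoinverse.

Section Stacking.
Variable R : realType.

(* Blocks stacked vertically: row k of block i is row i * a + k. *)
Definition stack q a b (F : 'I_q -> 'M[R]_(a, b)) : 'M[R]_(q * a, b) :=
  \matrix_(r, c) F (mxtens_unindex r).1 (mxtens_unindex r).2 c.

Definition vec a b (M : 'M[R]_(a, b)) : 'cV[R]_(b * a) :=
  stack (fun k : 'I_b => col k M).

Definition data_mx l q j (f : 'I_j -> nat -> 'cV[R]_q) : 'M[R]_(l * q, j) :=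
  stack (fun t : 'I_l => \matrix_(k, i) f i t k 0).

(* The sample f i t, read off from U = data_mx l f. *)
Definition sample l q j (U : 'M[R]_(l * q, j)) (i : 'I_j) (t : 'I_l) :
    'cV[R]_q :=
  \col_k U (mxtens_index (t, k)) i.

(* Rows a + 1, ..., a + q of G, padded with zeros past the last row of G. *)
Definition row_slice (a q : nat) N b (G : 'M[R]_(N, b)) : 'M[R]_(q, b) :=
  \matrix_(i, k) oapp (fun r : 'I_N => G r k) 0 (insub (a + i)%N).

(* v^T (x) M, with the row dimension 1 * a simplified to a. *)
Definition kron_row c a b (v : 'cV[R]_c) (M : 'M[R]_(a, b)) :
    'M[R]_(a, c * b) :=
  castmx (mul1n a, erefl _) (v^T *t M).

End Stacking.

Section Algorithm.
Variables (R : realType) (n m p l j : nat).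

(* A singular value decomposition                                            *)
(*   M = [Q1 Q2] [diag s, 0; 0, S2] [P1 P2]^T                                *)
(* in which s lists n largest singular values.  The sizes q and r of the     *)
(* complementary block are free, so that the full decomposition (square      *)
(* orthogonal factors, rectangular S2) and the reduced ones are all allowed. *)
Definition split_svd a b q r (M : 'M[R]_(a, b))
    (Q1 : 'M[R]_(a, n)) (Q2 : 'M[R]_(a, q)) (s : 'rV[R]_n) (S2 : 'M[R]_(q, r))
    (P1 : 'M[R]_(b, n)) (P2 : 'M[R]_(b, r)) : Prop :=
  [/\ (row_mx Q1 Q2)^T *m row_mx Q1 Q2 = 1%:M,
      (row_mx P1 P2)^T *m row_mx P1 P2 = 1%:M,
      is_diag_mx S2 /\ (forall i k, 0 <= S2 i k),
      (forall i, 0 <= s 0 i) /\ (forall i k h, S2 i k <= s 0 h)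
    & M = row_mx Q1 Q2 *m block_mx (diag_mx s) 0 0 S2 *m col_mx P1^T P2^T].

Definition input_projector (U : 'M[R]_(l * m, j)) : 'M[R]_j :=
  1%:M - U^T *m pseudoinv (U *m U^T) *m U.

Definition gamma_estimate (U : 'M[R]_(l * m, j)) (Y : 'M[R]_(l * p, j))
    (G : 'M[R]_(l * p, n)) : Prop :=
  exists (q r : nat) (Q1 : 'M[R]_(l * p, n)) (Q2 : 'M[R]_(l * p, q))
    (s : 'rV[R]_n) (S2 : 'M[R]_(q, r)) (P1 : 'M[R]_(j, n)) (P2 : 'M[R]_(j, r)),
    split_svd (Y *m input_projector U) Q1 Q2 s S2 P1 P2
    /\ G = Q1 *m diag_mx (map_mx Num.sqrt s).

Definition upsilon (U : 'M[R]_(l * m, j)) (A : 'M[R]_n) (C : 'M[R]_(p, n)) :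
    'M[R]_(j * (l * p), m * n + m * p + j * n) :=
  stack (fun i : 'I_j => stack (fun t : 'I_l =>
    row_mx
      (row_mx
        (\sum_(tau < l | (tau < t)%N)
           kron_row (sample U i tau) (C *m A ^+ (t - tau.+1)))
        (kron_row (sample U i t) (1%:M : 'M[R]_p)))
      (kron_row (delta_mx i 0 : 'cV[R]_j) (C *m A ^+ t)))).

(* (A, B, C, D, x) is an output of the multiple-record subspace system       *)
(* identification algorithm on the data U, Y.  The output depends on the     *)
(* choice of the singular value decomposition, hence a relation.             *)
Definition ssid_output (U : 'M[R]_(l * m, j)) (Y : 'M[R]_(l * p, j))
    (A : 'M[R]_n) (B : 'M[R]_(n, m)) (C : 'M[R]_(p, n)) (D : 'M[R]_(p, m))
    (x : 'I_j -> 'cV[R]_n) : Prop :=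
  exists2 G : 'M[R]_(l * p, n), gamma_estimate U Y G &
    [/\ C = row_slice 0 p G,
        A = pseudoinv (row_slice 0 (l.-1 * p) G) *m row_slice p (l.-1 * p) G
      & col_mx (col_mx (vec B) (vec D)) (stack x)
        = pseudoinv ((upsilon U A C)^T *m upsilon U A C)
            *m (upsilon U A C)^T *m vec Y].

End Algorithm.

(* Main.v *)
(* Since the behaviour is the kernel of a polynomial matrix of degree L, a
   free response whose first L outputs vanish can be preceded by n zero
   samples without leaving the behaviour; by Cayley-Hamilton and observability
   its initial state is 0.  Hence (C, A) is observable in L <= l - 1 steps.

   Writing Y = H U + Gam X, with Gam the extended observability matrix and X
   the matrix of initial states, the rank condition makes [U; X] row free, so
   X stays row free after projecting away the row space of U, and Y Pi =
   Gam (X Pi) has rank exactly n.  The truncated singular value decomposition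
   is then exact and its left factor is Gam T for an invertible T, which gives
   Ch = C T and, by shift invariance of Gam T, Ah = T^-1 A T.

   The least-squares problem of the last step is consistent, the true data
   transported by T being a solution; it remains to see that this solution is
   unique.  As U is row free, the records combine linearly to any input, so a
   homogeneous solution (B, D, x) provides, for every input, an initial state
   with zero response; impulses then give B = 0 and D = 0. *)
Require Import Defs.
Set Implicit Arguments.
Unset Strict Implicit.
Unset Printing Implicit Defensive.
Import Order.TTheory GRing.Theory Num.Theory.
Local Open Scope ring_scope.

(** * Stacked blocks, vectorisation and Kronecker rows *)

Lemma sum_mxtens_index (V : nmodType) (a b : nat) (F : 'I_(a * b) -> V) :
  \sum_r F r = \sum_i \sum_k F (mxtens_index (i, k)).
Proof.
rewrite pair_big (reindex (@mxtens_index a b)) /=; last first.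
  by exists (@mxtens_unindex a b) => r _;
    rewrite ?mxtens_indexK ?mxtens_unindexK.
by apply: eq_bigr => -[].
Qed.

Lemma stackE (R : realType) (q a b : nat) (F : 'I_q -> 'M[R]_(a, b)) i k c :
  stack F (mxtens_index (i, k)) c = F i k c.
Proof. by rewrite mxE mxtens_indexK. Qed.

Lemma stackP (R : realType) (q a b : nat) (F G : 'I_q -> 'M[R]_(a, b)) :
  stack F = stack G <-> F =1 G.
Proof.
split=> [eFG i | eFG]; last by apply/matrixP => r c; rewrite !mxE eFG.
by apply/matrixP => k c; rewrite -!stackE eFG.
Qed.

Lemma stack_surj (R : realType) (q a b : nat) (M : 'M[R]_(q * a, b)) :
  exists F, M = stack F.
Proof.
exists (fun i => \matrix_(k, c) M (mxtens_index (i, k)) c).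
apply/matrixP => r c; case: (mxtens_indexP r) => i k.
by rewrite stackE mxE.
Qed.

Lemma stack_mulmx (R : realType) (q a b c : nat) (F : 'I_q -> 'M[R]_(a, b))
    (M : 'M[R]_(b, c)) :
  stack F *m M = stack (fun i => F i *m M).
Proof.
by apply/matrixP => r k; rewrite !mxE; apply: eq_bigr => h _; rewrite mxE.
Qed.

Lemma stackD (R : realType) (q a b : nat) (F G : 'I_q -> 'M[R]_(a, b)) :
  stack F + stack G = stack (fun i => F i + G i).
Proof. by apply/matrixP => r k; rewrite !mxE. Qed.

Lemma stack0 (R : realType) (q a b : nat) :
  stack (fun _ : 'I_q => 0 : 'M[R]_(a, b)) = 0.
Proof. by apply/matrixP => r k; rewrite !mxE. Qed.

Lemma tr_stack_mulmx (R : realType) (q a b c : nat) (F : 'I_q -> 'M[R]_(a, b))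
    (G : 'I_q -> 'M[R]_(a, c)) :
  (stack F)^T *m stack G = \sum_i (F i)^T *m G i.
Proof.
apply/matrixP => r k; rewrite mxE summxE sum_mxtens_index.
apply: eq_bigr => i _; rewrite mxE; apply: eq_bigr => h _.
by rewrite mxE !stackE mxE.
Qed.

Lemma kron_row_stack (R : realType) (c a b d : nat) (v : 'cV[R]_c)
    (M : 'M[R]_(a, b)) (F : 'I_c -> 'M[R]_(b, d)) :
  kron_row v M *m stack F = \sum_k v k 0 *: (M *m F k).
Proof.
apply/matrixP => i e; rewrite mxE summxE sum_mxtens_index.
apply: eq_bigr => k _; rewrite mxE mxE big_distrr /=; apply: eq_bigr => h _.
rewrite stackE castmxE /= cast_ord_id.
have -> : cast_ord (esym (mul1n a)) i = mxtens_index (0, i) by apply: val_inj.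
by rewrite tensmxE mxE mulrA.
Qed.

Lemma kron_row_vec (R : realType) (c a b : nat) (v : 'cV[R]_c)
    (M : 'M[R]_(a, b)) (N : 'M[R]_(b, c)) :
  kron_row v M *m vec N = M *m N *m v.
Proof.
rewrite kron_row_stack; apply/colP => i.
rewrite summxE mxE; apply: eq_bigr => k _.
by rewrite !mxE mulrC; congr (_ * _); apply: eq_bigr => h _; rewrite mxE.
Qed.

(** In the regression matrix this picks out the initial state of a single record. *)
Lemma kron_row_delta (R : realType) (c a b d : nat) (k : 'I_c)
    (M : 'M[R]_(a, b)) (F : 'I_c -> 'M[R]_(b, d)) :
  kron_row (delta_mx k 0) M *m stack F = M *m F k.
Proof.
rewrite kron_row_stack (bigD1 k) //= big1 => [|h hk].
  by rewrite mxE !eqxx scale1r addr0.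
by rewrite mxE (negPf hk) scale0r.
Qed.

Lemma vec_surj (R : realType) (a b : nat) (v : 'cV[R]_(b * a)) :
  exists M : 'M[R]_(a, b), v = vec M.
Proof.
have [F ->] := stack_surj v; exists (\matrix_(r, k) F k r 0).
by apply/stackP => k; apply/colP => r; rewrite !mxE.
Qed.

Lemma vec_inj (R : realType) (a b : nat) : injective (@vec R a b).
Proof.
move=> M N /stackP eMN; apply/matrixP => r k.
by have /colP/(_ r) := eMN k; rewrite !mxE.
Qed.

Lemma col_data_mx (R : realType) (l q j : nat) (f : 'I_j -> nat -> 'cV[R]_q) i :
  col i (data_mx l f) = stack (fun t : 'I_l => f i t).
Proof. by apply/colP => r; rewrite !mxE. Qed.

Lemma vec_data_mx (R : realType) (l q j : nat) (f : 'I_j -> nat -> 'cV[R]_q) :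
  vec (data_mx l f) = stack (fun i => stack (fun t : 'I_l => f i t)).
Proof. by apply/stackP => i; rewrite col_data_mx. Qed.

Lemma sample_data_mx (R : realType) (l q j : nat)
    (f : 'I_j -> nat -> 'cV[R]_q) (i : 'I_j) (t : 'I_l) :
  sample (data_mx l f) i t = f i t.
Proof. by apply/colP => k; rewrite mxE stackE mxE. Qed.

Lemma data_mx_mul_col (R : realType) (l q j : nat)
    (f : 'I_j -> nat -> 'cV[R]_q) (c : 'cV[R]_j) :
  data_mx l f *m c = stack (fun t : 'I_l => \sum_i c i 0 *: f i t).
Proof.
rewrite stack_mulmx; apply/stackP => t; apply/colP => k.
rewrite summxE mxE; apply: eq_bigr => i _.
by rewrite !mxE mulrC.
Qed.

Lemma row_slice_stack (R : realType) (a k q N b : nat)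
    (F : nat -> 'M[R]_(q, b)) :
  (a + k <= N)%N ->
  row_slice (a * q) (k * q) (stack (fun t : 'I_N => F t))
    = stack (fun t : 'I_k => F (a + t)%N).
Proof.
move=> akN; apply/matrixP => r c; case: (mxtens_indexP r) => t h.
have tN : (a + t < N)%N by apply: leq_trans akN; rewrite ltn_add2l.
rewrite stackE mxE.
have -> : (a * q + mxtens_index (t, h))%N
    = mxtens_index (Ordinal tN, h) :> nat by rewrite /= addnA -mulnDl.
by rewrite valK /= stackE.
Qed.

Lemma row_slice0_stack (R : realType) (q N b : nat) (F : nat -> 'M[R]_(q, b)) :
  (0 < N)%N -> row_slice 0 q (stack (fun t : 'I_N => F t)) = F 0%N.
Proof.
move=> N0; apply/matrixP => h c; rewrite mxE.
have -> : (0 + h)%N = mxtens_index (Ordinal N0, h) :> nat by [].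
by rewrite valK /= stackE.
Qed.

(** * Pseudoinverses, least squares, input projector and singular values *)

(** Full column rank, written [row_free M^T], lets [M] be cancelled on the left of the Penrose
    equation [M X M = M]. *)
Lemma pseudoinv_row_free_tr (R : realType) (a b : nat) (M : 'M[R]_(a, b)) :
  row_free M^T -> pseudoinv M *m M = 1%:M.
Proof.
move=> fM; have [MXM _ _ _] := pseudoinvP M.
apply: trmx_inj; apply: (row_free_inj fM).
by rewrite -!trmx_mul mulmxA MXM mulmx1.
Qed.

Lemma pseudoinv_unitmx (R : realType) (a : nat) (M : 'M[R]_a) :
  M \in unitmx -> pseudoinv M = invmx M.
Proof.
move=> uM; rewrite -[LHS](mulmxK uM) pseudoinv_row_free_tr ?mul1mx //.
by rewrite row_free_unit unitmx_tr.
Qed.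

Lemma inj_row_free_tr (R : realType) (a b : nat) (M : 'M[R]_(a, b)) :
  (forall v : 'cV_b, M *m v = 0 -> v = 0) -> row_free M^T.
Proof.
move=> injM; apply: inj_row_free => v vM0; apply: trmx_inj.
by rewrite trmx0; apply: injM; rewrite -[M]trmxK -trmx_mul vM0 trmx0.
Qed.

Lemma least_squares (R : realType) (a b : nat) (M : 'M[R]_(a, b)) (v : 'cV_b) :
  row_free M^T -> pseudoinv (M^T *m M) *m M^T *m (M *m v) = v.
Proof.
move=> fM; have uM : M^T *m M \in unitmx by rewrite -{2}[M]trmxK gram_unitmx.
by rewrite pseudoinv_unitmx // mulmxA -(mulmxA _ _ M) mulVmx // mul1mx.
Qed.

Lemma mul_input_projector (R : realType) (m l j : nat) (U : 'M[R]_(l * m, j)) :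
  row_free U -> U *m input_projector U = 0.
Proof.
move=> fU; rewrite /input_projector mulmxBr mulmx1 !mulmxA.
by rewrite pseudoinv_unitmx ?gram_unitmx // mulmxV ?gram_unitmx // mul1mx subrr.
Qed.

(** If the projector kills [v X], then [v X] lies in the row space of [U], which is a linear
    relation between the rows of [[U; X]]. *)
Lemma row_free_projected (R : realType) (n m l j : nat)
    (U : 'M[R]_(l * m, j)) (X : 'M[R]_(n, j)) :
  row_free (col_mx U X) -> row_free (X *m input_projector U).
Proof.
move=> fUX; apply: inj_row_free => v vXP0.
pose K := U^T *m pseudoinv (U *m U^T).
have : row_mx (- (v *m X *m K)) v *m col_mx U X = 0 *m col_mx U X.
  rewrite mul0mx mul_row_col -vXP0 /input_projector mulmxBr mulmx1 mulmxBr.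
  by rewrite /K !mulmxA mulNmx addrC.
by move/(row_free_inj fUX); rewrite -row_mx0 => /eq_row_mx[].
Qed.

Lemma diag_mx_unitP (R : realType) (n : nat) (s : 'rV[R]_n) :
  reflect (forall i, s 0 i != 0) (diag_mx s \in unitmx).
Proof.
rewrite unitmxE det_diag unitfE.
by apply: (iffP (prodf_neq0 _ _)) => [h i|h i _]; apply: h.
Qed.

(** Orthonormal factors preserve rank, so [diag_mx s] and [S2] share the rank [n]. A zero in [s]
    would force [S2 = 0], leaving a singular [diag_mx s] to have rank [n] alone, which is absurd; so
    [diag_mx s] is invertible and no rank is left for [S2]. *)
Lemma split_svd_rank (R : realType) (n a b q r : nat) (M : 'M[R]_(a, b))
    (Q1 : 'M[R]_(a, n)) (Q2 : 'M[R]_(a, q)) (s : 'rV[R]_n) (S2 : 'M[R]_(q, r))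
    (P1 : 'M[R]_(b, n)) (P2 : 'M[R]_(b, r)) :
  split_svd M Q1 Q2 s S2 P1 P2 -> \rank M = n ->
  [/\ forall i, 0 < s 0 i, P1^T *m P1 = 1%:M & M = Q1 *m diag_mx s *m P1^T].
Proof.
case=> QQ PP [_ S2ge0] [sge0 S2s] defM rM.
have rk : (\rank (diag_mx s) + \rank S2)%N = n.
  transitivity (\rank M) => //; rewrite -rank_diag_block_mx.
  apply/eqP; rewrite eqn_leq; apply/andP; split.
    have -> : block_mx (diag_mx s) 0 0 S2
        = (row_mx Q1 Q2)^T *m M *m row_mx P1 P2.
      rewrite defM -tr_row_mx !mulmxA QQ mul1mx -mulmxA PP mulmx1 //.
    by apply: leq_trans (mxrankM_maxl _ _) (mxrankM_maxr _ _).
  rewrite [in X in (X <= _)%N]defM.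
  by apply: leq_trans (mxrankM_maxl _ _) (mxrankM_maxr _ _).
have s_gt0 i : 0 < s 0 i.
  rewrite lt_def sge0 andbT; apply/eqP => si0.
  have S20 : S2 = 0.
    apply/matrixP => h k; apply/eqP; rewrite [X in _ == X]mxE eq_le S2ge0 andbT.
    by rewrite -si0 S2s.
  have /diag_mx_unitP/(_ i) : diag_mx s \in unitmx.
    by rewrite -row_free_unit /row_free -[X in _ == X]rk S20 mxrank0 addn0.
  by rewrite si0 eqxx.
have us : diag_mx s \in unitmx.
  by apply/diag_mx_unitP => i; rewrite gt_eqF.
have S20 : S2 = 0.
  apply/eqP; rewrite -mxrank_eq0 -(eqn_add2l (\rank (diag_mx s))) rk addn0.
  by rewrite mxrank_unit.
split=> //; last first.
  rewrite defM S20 mul_row_block !mulmx0 addr0 add0r mul_row_col.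
  by rewrite mul0mx addr0.
by move: PP; rewrite tr_row_mx mul_col_row (scalar_mx_block n r)
  => /eq_block_mx[].
Qed.

(** * Finite-horizon observability and the lag *)

Definition observable_in (R : realType) (n p k : nat) (A : 'M[R]_n)
    (C : 'M[R]_(p, n)) : Prop :=
  forall v : 'cV_n, (forall t, (t < k)%N -> C *m A ^+ t *m v = 0) -> v = 0.

(** The right-hand side of the regression equations of the algorithm, used for the true and the
    estimated matrices alike. *)
Definition response (R : realType) (n m p : nat) (A : 'M[R]_n)
    (B : 'M[R]_(n, m)) (C : 'M[R]_(p, n)) (D : 'M[R]_(p, m))
    (u : nat -> 'cV[R]_m) (x0 : 'cV[R]_n) (t : nat) : 'cV[R]_p :=
  \sum_(tau < t) C *m A ^+ (t - tau.+1) *m B *m u tau + D *m u t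
    + C *m A ^+ t *m x0.

Lemma observable_in_leq (R : realType) (n p k k' : nat) (A : 'M[R]_n)
    (C : 'M[R]_(p, n)) :
  (k <= k')%N -> observable_in k A C -> observable_in k' A C.
Proof.
by move=> kk' obs v Cv0; apply: obs => t tk; apply: Cv0; apply: leq_trans kk'.
Qed.

Lemma row_free_obsv_mx (R : realType) (n p k : nat) (A : 'M[R]_n)
    (C : 'M[R]_(p, n)) :
  observable_in k A C -> row_free (stack (fun t : 'I_k => C *m A ^+ t))^T.
Proof.
move=> obs; apply: inj_row_free_tr => v; rewrite stack_mulmx -(stack0 _ k).
move=> /stackP Cv0; apply: obs => t tk; apply: (Cv0 (Ordinal tk)).
Qed.

(** Reduction modulo the characteristic polynomial of [A] turns [A ^+ t] into a combination of
    powers below [n]. *)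
Lemma unobservable_pow (R : realType) (n p : nat) (A : 'M[R]_n)
    (C : 'M[R]_(p, n)) (v : 'cV[R]_n) :
  (forall t, (t < n)%N -> C *m A ^+ t *m v = 0) ->
  forall t, C *m A ^+ t *m v = 0.
Proof.
case: n => [|n] in A C v *; first by move=> _ t; rewrite [v]flatmx0 mulmx0.
move=> Cv0 t.
have -> : A ^+ t = horner_mx A ('X^t %% char_poly A).
  rewrite -[in LHS](horner_mx_X A) -rmorphXn {1}(divp_eq 'X^t (char_poly A)).
  by rewrite rmorphD rmorphM /= Cayley_Hamilton mulr0 add0r.
set r := _ %% _.
have szr : (size r <= n.+1)%N.
  by rewrite -ltnS -(size_char_poly A) ltn_modp monic_neq0 ?char_poly_monic.
rewrite -(coefK r) poly_def rmorph_sum /= mulmx_sumr mulmx_suml big1 // => i _.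
rewrite linearZ /= rmorphXn /= horner_mx_X -scalemxAr -scalemxAl.
by rewrite Cv0 ?scaler0 // (leq_trans _ szr).
Qed.

(** The bridge from polynomial matrices to states: through it [L < l] becomes observability from
    [l - 1] samples. *)
Lemma lag_observable (R : realType) (n m p : nat) (A : 'M[R]_n)
    (B : 'M[R]_(n, m)) (C : 'M[R]_(p, n)) (D : 'M[R]_(p, m))
    (P : 'M[{poly R}]_(p, m + p)) :
  observable A B C D -> kernel_representation A B C D P ->
  observable_in (mx_degree P) A C.
Proof.
move=> obs ker v Cv0.
pose w t : 'cV_(m + p) := col_mx 0 (C *m A ^+ t *m v).
(* The free response from [v], delayed by [n] zero samples. *)
pose w' t := if (t < n)%N then 0 else w (t - n)%N.
have free_eqs (z : 'cV_n) (y : nat -> 'cV_p) :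
    (forall t, y t = C *m A ^+ t *m z) ->
    forall t, system_eqs A B C D (fun=> 0) (fun k => A ^+ k *m z) y t.
  move=> yE t; split; rewrite mulmx0 addr0.
    by rewrite exprS -mulmxE mulmxA.
  by rewrite yE mulmxA.
have degP i k : (size (P i k) <= (mx_degree P).+1)%N.
  apply: leq_trans (leqSpred _) _; rewrite ltnS.
  apply: leq_trans (leq_bigmax i : row_degree P i <= _)%N.
  exact: (leq_bigmax (F := fun k => (size (P i k)).-1)).
have wbeh : behavior A B C D w.
  exists (fun t => A ^+ t *m v) => t.
  rewrite /system_eqs /w col_mxKu col_mxKd.
  exact: (free_eqs v (fun t => C *m A ^+ t *m v)).
have [x' x'E] : behavior A B C D w'.
  apply/ker => t; have [tn|nt] := ltnP t n; last first.
    have /ker/(_ (t - n)%N) <- := wbeh.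
    apply/colP => i; rewrite !mxE; apply: eq_bigr => k _; apply: eq_bigr => d _.
    by rewrite /w' ltnNge (leq_trans nt (leq_addr _ _)) /= addnBAC.
  apply/colP => i; rewrite !mxE; apply: big1 => k _; apply: big1 => d _.
  rewrite /w'; case: ltnP => [_|ntd]; first by rewrite mxE mulr0.
  (* Here [t < n], so the sample of [w] has index [t + d - n < d <= mx_degree P], where [Cv0]
     applies. *)
  rewrite /w Cv0 ?col_mx0 ?mxE ?mulr0 //.
  have dL : (d <= mx_degree P)%N := leq_trans (ltn_ord d) (degP i k).
  by rewrite ltn_subLR // -addSn leq_add.
have uw' t : usubmx (w' t) = 0.
  by rewrite /w'; case: ifP => _; rewrite ?linear0 // col_mxKu.
have x'A t : x' t = A ^+ t *m x' 0%N.
  elim: t => [|t IH]; first by rewrite expr0 mul1mx.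
  by have [-> _] := x'E t; rewrite uw' mulmx0 addr0 IH exprS -mulmxE mulmxA.
have yw' t : dsubmx (w' t) = C *m A ^+ t *m x' 0%N.
  by have [_ ->] := x'E t; rewrite uw' mulmx0 addr0 x'A mulmxA.
(* The [n] leading zeros of [w'] silence the free response from its initial state at all later
   times. *)
have Cx'0 t : C *m A ^+ t *m x' 0%N = 0.
  apply: unobservable_pow => k kn.
  by rewrite -yw' /w' kn linear0.
have Cvall t : C *m A ^+ t *m v = 0.
  by rewrite -(Cx'0 (t + n)%N) -yw' /w' ltnNge leq_addl /= addnK col_mxKd.
have := obs (fun=> 0) (fun t => A ^+ t *m v) (fun t => A ^+ t *m 0) (fun=> 0).
rewrite !expr0 !mul1mx; apply; apply: free_eqs => t.
  by rewrite Cvall.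
by rewrite mulmx0.
Qed.


(** * Responses, coordinate changes and impulses *)

(** Variation of constants, confined to the window on which a record satisfies the system
    equations. *)
Lemma system_response (R : realType) (n m p l : nat) (A : 'M[R]_n)
    (B : 'M[R]_(n, m)) (C : 'M[R]_(p, n)) (D : 'M[R]_(p, m))
    (u : nat -> 'cV[R]_m) (x : nat -> 'cV[R]_n) (y : nat -> 'cV[R]_p) :
  (forall t, (t < l)%N -> system_eqs A B C D u x y t) ->
  forall t, (t < l)%N -> y t = response A B C D u (x 0%N) t.
Proof.
move=> sys.
have xE t : (t <= l)%N ->
    x t = \sum_(tau < t) A ^+ (t - tau.+1) *m B *m u tau + A ^+ t *m x 0%N.
  elim: t => [|t IH] tl; first by rewrite big_ord0 add0r expr0 mul1mx.
  have [-> _] := sys t tl; rewrite (IH (ltnW tl)) mulmxDr addrAC exprS -mulmxE.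
  rewrite -mulmxA; congr (_ + _).
  rewrite big_ord_recr /= subnn expr0 mul1mx mulmx_sumr; congr (_ + _).
  apply: eq_bigr => tau _.
  by rewrite subSS -(subnSK (ltn_ord tau)) exprS -mulmxE !mulmxA.
move=> t tl; have [_ ->] := sys t tl.
rewrite (xE t (ltnW tl)) /response mulmxDr !mulmxA addrAC mulmx_sumr.
by do 2!congr (_ + _); apply: eq_bigr => tau _; rewrite !mulmxA.
Qed.

(** Causality: it serves because combined records match a prescribed input only on the recorded
    window. *)
Lemma eq_response (R : realType) (n m p : nat) (A : 'M[R]_n)
    (B : 'M[R]_(n, m)) (C : 'M[R]_(p, n)) (D : 'M[R]_(p, m))
    (u u' : nat -> 'cV[R]_m) (x0 : 'cV[R]_n) (t : nat) :
  (forall tau, (tau <= t)%N -> u tau = u' tau) ->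
  response A B C D u x0 t = response A B C D u' x0 t.
Proof.
move=> uu'; rewrite /response uu' //; do 2!congr (_ + _).
by apply: eq_bigr => tau _; rewrite uu' // ltnW.
Qed.

Lemma response_sum (R : realType) (n m p j : nat) (A : 'M[R]_n)
    (B : 'M[R]_(n, m)) (C : 'M[R]_(p, n)) (D : 'M[R]_(p, m))
    (c : 'I_j -> R) (u : 'I_j -> nat -> 'cV[R]_m) (x0 : 'I_j -> 'cV[R]_n)
    (t : nat) :
  response A B C D (fun tau => \sum_i c i *: u i tau) (\sum_i c i *: x0 i) t
    = \sum_i c i *: response A B C D (u i) (x0 i) t.
Proof.
rewrite /response; under eq_bigr do rewrite mulmx_sumr.
rewrite exchange_big !mulmx_sumr -!big_split /=; apply: eq_bigr => i _.
rewrite -!scalemxAr !scalerDr scaler_sumr; do 2!congr (_ + _).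
by apply: eq_bigr => tau _; rewrite scalemxAr.
Qed.

Lemma mulmx_similar_pow (R : realType) (n p : nat) (T A : 'M[R]_n)
    (C : 'M[R]_(p, n)) (k : nat) :
  T \in unitmx ->
  C *m T *m (invmx T *m A *m T) ^+ k = C *m A ^+ k *m T.
Proof.
move=> uT; elim: k => [|k IH]; first by rewrite !expr0 !mulmx1.
by rewrite !exprSr -!mulmxE (mulmxA (C *m T)) IH !mulmxA mulmxK.
Qed.

Lemma observable_in_similar (R : realType) (n p k : nat) (T A : 'M[R]_n)
    (C : 'M[R]_(p, n)) :
  T \in unitmx -> observable_in k A C ->
  observable_in k (invmx T *m A *m T) (C *m T).
Proof.
move=> uT obs v Cv0; rewrite -(mulKmx uT v) (obs (T *m v)) ?mulmx0 // => t tk.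
by rewrite mulmxA -mulmx_similar_pow // Cv0.
Qed.

Lemma response_similar (R : realType) (n m p : nat) (T A : 'M[R]_n)
    (B : 'M[R]_(n, m)) (C : 'M[R]_(p, n)) (D : 'M[R]_(p, m))
    (u : nat -> 'cV[R]_m) (x0 : 'cV[R]_n) (t : nat) :
  T \in unitmx ->
  response (invmx T *m A *m T) (invmx T *m B) (C *m T) D u (invmx T *m x0) t
    = response A B C D u x0 t.
Proof.
move=> uT.
rewrite /response mulmx_similar_pow // !mulmxA mulmxK //; do 2!congr (_ + _).
by apply: eq_bigr => tau _; rewrite mulmx_similar_pow // !mulmxA mulmxK.
Qed.

(** The factor of [e] is the Markov parameter of delay [t - s], with [D] at delay 0; the test
    [t < s] guards against truncated subtraction. *)
Lemma response_impulse (R : realType) (n m p : nat) (A : 'M[R]_n)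
    (B : 'M[R]_(n, m)) (C : 'M[R]_(p, n)) (D : 'M[R]_(p, m))
    (e : 'cV[R]_m) (x0 : 'cV[R]_n) (s t : nat) :
  response A B C D (fun tau => if tau == s then e else 0) x0 t
    = (if (t < s)%N then 0
       else (if (t - s)%N is k.+1 then C *m A ^+ k *m B else D) *m e)
      + C *m A ^+ t *m x0.
Proof.
rewrite /response; congr (_ + _).
have zero (tau : 'I_t) : tau != s :> nat ->
    C *m A ^+ (t - tau.+1) *m B *m (if tau == s :> nat then e else 0) = 0.
  by move=> /negPf ->; rewrite mulmx0.
have [ts|st|ets] := ltngtP t s.
- rewrite mulmx0 addr0 big1 // => tau _; apply: zero.
  by rewrite ltn_eqF // (ltn_trans _ ts).
- rewrite mulmx0 addr0 (bigD1 (Ordinal st)) //= big1 => [|tau ne].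
    by rewrite eqxx addr0 -(subnSK st).
  exact: zero.
- rewrite big1 => [|tau _]; first by rewrite add0r ets subnn.
  apply: zero.
  by rewrite ltn_eqF // -ets.
Qed.

(* An impulse at time k - i excites only the i-th Markov parameter up to time
   k, so strong induction on i shows that the parameters vanish one by one. *)
Lemma unobservable_inputs (R : realType) (n m p k : nat) (A : 'M[R]_n)
    (B : 'M[R]_(n, m)) (C : 'M[R]_(p, n)) (D : 'M[R]_(p, m)) :
  observable_in k A C ->
  (forall u, exists x0, forall t, (t <= k)%N -> response A B C D u x0 t = 0) ->
  B = 0 /\ D = 0.
Proof.
move=> obs free.
pose h i := if i is i'.+1 then C *m A ^+ i' *m B else D.
have h0 i : (i <= k)%N -> h i = 0.
  elim/ltn_ind: i => i IH ik; apply/row_matrixP => r.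
  apply/rowP => c; rewrite row0 mxE [RHS]mxE.
  pose e : 'cV[R]_m := delta_mx c 0.
  have [x0 x0E] := free (fun tau => if tau == (k - i)%N then e else 0).
  (* Before time [k] only delays below [i] occur, and their parameters vanish by induction; what
     remains is the free response of [x0]. *)
  have x00 : x0 = 0.
    apply: obs => t tk; have := x0E t (ltnW tk); rewrite response_impulse.
    case: ltnP => [_|kit]; first by rewrite add0r.
    have ti : (t - (k - i) < i)%N by rewrite ltn_subLR // subnK.
    by rewrite -/(h _) IH ?mul0mx ?add0r // (leq_trans (ltnW ti)).
  have := x0E k (leqnn k); rewrite response_impulse x00 mulmx0 addr0.
  rewrite ltnNge leq_subr /= subKn // -/(h i) -colE => /colP/(_ r).
  by rewrite !mxE.
split; last exact: (h0 0%N).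
apply/matrixP => r c; rewrite [RHS]mxE.
suff /colP/(_ r) : col c B = 0 by rewrite !mxE.
(* [C A^t B] is the parameter of delay [t.+1 <= k], so each column of [B] is an unobservable
   state. *)
by apply: obs => t tk; rewrite colE mulmxA -/(h t.+1) h0 // mul0mx.
Qed.

(** * The data equation and the regression matrix *)

(** [H] is the block lower triangular Toeplitz matrix of Markov parameters; it is chosen before [u]
    and [x0], so all records share it. *)
Lemma response_mx (R : realType) (n m p l : nat) (A : 'M[R]_n)
    (B : 'M[R]_(n, m)) (C : 'M[R]_(p, n)) (D : 'M[R]_(p, m)) :
  exists H : 'M[R]_(l * p, l * m), forall u x0,
    stack (fun t : 'I_l => response A B C D u x0 t)
      = H *m stack (fun t : 'I_l => u t)
        + stack (fun t : 'I_l => C *m A ^+ t) *m x0.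
Proof.
pose K (t tau : nat) := if (tau < t)%N then C *m A ^+ (t - tau.+1) *m B
  else if tau == t then D else 0.
exists (stack (fun t : 'I_l => (stack (fun tau : 'I_l => (K t tau)^T))^T)).
move=> u x0; rewrite !stack_mulmx stackD; apply/stackP => t; congr (_ + _).
rewrite tr_stack_mulmx; under [RHS]eq_bigr do rewrite trmxK.
rewrite (big_ord_widen l (fun tau => C *m A ^+ (t - tau.+1) *m B *m u tau))
  ?(ltnW (ltn_ord t)) //.
rewrite [RHS](bigID (fun tau : 'I_l => tau < t)%N) /=; congr (_ + _).
  by apply: eq_bigr => tau; rewrite /K => ->.
rewrite (bigD1 t) ?ltnn //= big1 ?addr0 => [|tau /andP[tt ne]].
  by rewrite /K ltnn eqxx.
by rewrite /K (negPf tt) -[_ == _ :> nat]/(tau == t) (negPf ne) mul0mx.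
Qed.

(** Arbitrary [B], [D] and [x0] are allowed, so this describes both the exact solution and the
    kernel of the regression matrix. *)
Lemma upsilonM (R : realType) (n m p l j : nat) (A : 'M[R]_n)
    (B : 'M[R]_(n, m)) (C : 'M[R]_(p, n)) (D : 'M[R]_(p, m))
    (u : 'I_j -> nat -> 'cV[R]_m) (x0 : 'I_j -> 'cV[R]_n) :
  upsilon (data_mx l u) A C *m col_mx (col_mx (vec B) (vec D)) (stack x0)
    = stack (fun i => stack (fun t : 'I_l => response A B C D (u i) (x0 i) t)).
Proof.
rewrite stack_mulmx; apply/stackP => i; rewrite stack_mulmx; apply/stackP => t.
rewrite !mul_row_col kron_row_vec mul1mx kron_row_delta sample_data_mx.
rewrite mulmx_suml; do 2!congr (_ + _).
rewrite (big_ord_widen l (fun tau => C *m A ^+ (t - tau.+1) *m B *m u i tau))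
  ?(ltnW (ltn_ord t)) //.
by apply: eq_bigr => tau _; rewrite kron_row_vec sample_data_mx.
Qed.

(** Records one sample longer than the observability horizon provide the times 0 to [l] that
    [unobservable_inputs] asks for. *)
Lemma row_free_upsilon (R : realType) (n m p l j : nat) (A : 'M[R]_n)
    (C : 'M[R]_(p, n)) (u : 'I_j -> nat -> 'cV[R]_m) :
  observable_in l A C -> row_free (data_mx l.+1 u) ->
  row_free (upsilon (data_mx l.+1 u) A C)^T.
Proof.
move=> obs fU; apply: inj_row_free_tr => th.
rewrite -[th]vsubmxK -[usubmx th]vsubmxK.
have [B ->] := vec_surj (usubmx (usubmx th)).
have [D ->] := vec_surj (dsubmx (usubmx th)).
have [x0 ->] := stack_surj (dsubmx th).
rewrite upsilonM -(stack0 R j) => /stackP resp0.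
have {}resp0 i t : (t <= l)%N -> response A B C D (u i) (x0 i) t = 0.
  move=> tl; have := resp0 i; rewrite -(stack0 R l.+1) => /stackP.
  by move/(_ (Ordinal (tl : (t < l.+1)%N))).
have [V UV] := row_freeP fU.
have [B0 D0] : B = 0 /\ D = 0.
  apply: (unobservable_inputs obs) => v.
  (* The right inverse [V] of the input data gives weights with which the records reproduce [v]; the
     same weights combine their initial states. *)
  pose c := V *m stack (fun t : 'I_l.+1 => v t).
  exists (\sum_i c i 0 *: x0 i) => t tl.
  have vE s : (s <= l)%N -> v s = \sum_i c i 0 *: u i s.
    move=> sl; have : data_mx l.+1 u *m c = stack (fun t : 'I_l.+1 => v t).
      by rewrite /c mulmxA UV mul1mx.
    rewrite data_mx_mul_col => /stackP.
    by move/(_ (Ordinal (sl : (s < l.+1)%N))) <-.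
  rewrite (@eq_response _ _ _ _ _ _ _ _ _ (fun s => \sum_i c i 0 *: u i s))
    => [|s st].
    by rewrite response_sum big1 // => i _; rewrite resp0 ?scaler0.
  exact: vE (leq_trans st tl).
have x00 i : x0 i = 0.
  apply: obs => t tl; rewrite -(resp0 i t (ltnW tl)).
  rewrite /response B0 D0 mul0mx addr0.
  by rewrite big1 ?add0r // => tau _; rewrite mulmx0 mul0mx.
have -> : stack x0 = 0 by rewrite -(stack0 R j); apply/stackP.
have vec0 a b : vec (0 : 'M[R]_(a, b)) = 0.
  by rewrite -(stack0 R b a); apply/stackP => k; rewrite linear0.
by rewrite B0 D0 !vec0 !col_mx0.
Qed.

(** * Recovery of the observability matrix and of the system *)

Lemma gamma_estimate_similar (R : realType) (n m p l j : nat)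
    (U : 'M[R]_(l * m, j)) (Y : 'M[R]_(l * p, j)) (H : 'M[R]_(l * p, l * m))
    (Gam G : 'M[R]_(l * p, n)) (X : 'M[R]_(n, j)) :
  Y = H *m U + Gam *m X -> row_free Gam^T -> row_free U ->
  row_free (col_mx U X) -> gamma_estimate U Y G ->
  exists2 T, T \in unitmx & G = Gam *m T.
Proof.
move=> YE fGam fU fUX [q [r [Q1 [Q2 [s [S2 [P1 [P2 [svd ->]]]]]]]]].
set M := Y *m _ in svd.
have ME : M = Gam *m (X *m input_projector U).
  by rewrite /M YE mulmxDl -mulmxA mul_input_projector // mulmx0 add0r mulmxA.
have rM : \rank M = n.
  rewrite ME mxrankMfree ?row_free_projected // -mxrank_tr.
  exact/eqP.
have [s_gt0 P1P1 MQ] := split_svd_rank svd rM.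
pose d := map_mx Num.sqrt s; pose d' := map_mx (fun a => (Num.sqrt a)^-1) s.
have dd' : diag_mx s *m diag_mx d' = diag_mx d.
  rewrite mulmx_diag; congr diag_mx; apply/rowP => i; rewrite !mxE.
  by rewrite -{1}[s 0 i]sqr_sqrtr ?ltW // expr2 mulfK // gt_eqF // sqrtr_gt0.
(* Obtained by multiplying [Gam X Pi = Q1 S P1^T] on the right by [P1 S^(-1/2)], which leaves
   [Q1 S^(1/2)]. *)
pose T := X *m input_projector U *m P1 *m diag_mx d'.
have GE : Q1 *m diag_mx d = Gam *m T.
  rewrite /T !mulmxA -(mulmxA Gam) -ME MQ -(mulmxA _ P1^T) P1P1 mulmx1.
  by rewrite -mulmxA dd'.
exists T => //; rewrite -row_free_unit.
have QQ : Q1^T *m Q1 = 1%:M.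
  by case: svd => + _ _ _ _; rewrite tr_row_mx mul_col_row (scalar_mx_block n q)
    => /eq_block_mx[].
have ud : diag_mx d \in unitmx.
  by apply/diag_mx_unitP => i; rewrite mxE gt_eqF // sqrtr_gt0.
(* Since [Gam T = Q1 diag d], multiplying by [Q1^T] isolates [diag d]; this gives a left inverse of
   [T], enough for a square matrix. *)
apply/row_freeP; exists (invmx (diag_mx d) *m Q1^T *m Gam).
apply: mulmx1C; rewrite -!mulmxA -GE (mulmxA _ Q1) QQ mul1mx.
by rewrite mulVmx.
Qed.

Theorem theorem1 (R : realType) (n m p j l L : nat)
    (A : 'M[R]_n) (B : 'M[R]_(n, m)) (C : 'M[R]_(p, n)) (D : 'M[R]_(p, m))
    (u : 'I_j -> nat -> 'cV[R]_m) (x : 'I_j -> nat -> 'cV[R]_n)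
    (y : 'I_j -> nat -> 'cV[R]_p) :
  controllable A B -> observable A B C D ->
  maximal_lag A B C D L -> (L < l)%N ->
  (forall (i : 'I_j) (t : nat), (t < l)%N ->
     system_eqs A B C D (u i) (x i) (y i) t) ->
  \rank (col_mx (data_mx l u) (data_mx l y)) = (m * l + n)%N ->
  \rank (data_mx l u) = (m * l)%N ->
  forall (Ah : 'M[R]_n) (Bh : 'M[R]_(n, m)) (Ch : 'M[R]_(p, n))
    (Dh : 'M[R]_(p, m)) (xh : 'I_j -> 'cV[R]_n),
  ssid_output (data_mx l u) (data_mx l y) Ah Bh Ch Dh xh ->
  exists2 T : 'M[R]_n, T \in unitmx &
    [/\ A = T *m Ah *m invmx T, B = T *m Bh, C = Ch *m invmx T, D = Dh
      & forall i : 'I_j, x i 0%N = T *m xh i].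
Proof.
move=> _ obs [P [_ ker _ LE]] Ll sys rUY rU Ah Bh Ch Dh xh.
case=> G Gest [ChE AhE thE].
(* From here [l] is the record length minus one, the number of block rows in the shift equation. *)
case: l => // l in Ll sys rUY rU G Gest ChE AhE thE *.
have obs_l : observable_in l A C.
  by apply: observable_in_leq (lag_observable obs ker); rewrite -LE.
set U := data_mx l.+1 u in rUY rU Gest thE *.
set Y := data_mx l.+1 y in rUY Gest thE *.
pose X : 'M[R]_(n, j) := \matrix_(k, i) x i 0%N k 0.
pose Gam k := stack (fun t : 'I_k => C *m A ^+ t).
have yE i t : (t < l.+1)%N -> y i t = response A B C D (u i) (x i 0%N) t.
  exact: (system_response (sys i)).
have [H HE] := response_mx l.+1 A B C D.
have YE : Y = H *m U + Gam l.+1 *m X.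
  apply/matrixP => r i.
  suff /colP/(_ r) : col i Y = H *m col i U + Gam l.+1 *m x i 0%N.
    by rewrite !mxE => ->; congr (_ + _); apply: eq_bigr => k _; rewrite !mxE.
  by rewrite !col_data_mx -HE; apply/stackP => t; rewrite yE.
have fU : row_free U by rewrite /row_free rU mulnC.
have fUX : row_free (col_mx U X).
  rewrite /row_free eqn_leq rank_leq_row /=.
  (* [[U; Y]] factors through [[U; X]], whose number of rows already equals the assumed rank. *)
  suff: (\rank (col_mx U Y) <= \rank (col_mx U X))%N by rewrite rUY mulnC.
  have -> : col_mx U Y = block_mx 1%:M 0 H (Gam l.+1) *m col_mx U X.
    by rewrite mul_block_col mul1mx mul0mx addr0 -YE.
  exact: mxrankM_maxr.
have fGam k : (l <= k)%N -> row_free (Gam k)^T.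
  by move=> lk; apply: row_free_obsv_mx; apply: observable_in_leq obs_l.
have [T uT GE] := gamma_estimate_similar YE (fGam _ (leqnSn l)) fU fUX Gest.
have {}GE : G = stack (fun t : 'I_l.+1 => C *m A ^+ t *m T).
  by rewrite GE stack_mulmx.
have {}ChE : Ch = C *m T.
  rewrite ChE GE (row_slice0_stack (fun t => C *m A ^+ t *m T)) //.
  by rewrite expr0 mulmx1.
have {}AhE : Ah = invmx T *m A *m T.
  have slice a : (a <= 1)%N -> row_slice (a * p) (l * p) G
      = stack (fun t : 'I_l => C *m A ^+ (a + t) *m T).
    move=> a1; rewrite GE.
    apply: (row_slice_stack (N := l.+1) (fun t => C *m A ^+ t *m T)).
    by rewrite -add1n leq_add2r.
  have := slice 1%N isT; have := slice 0%N isT; rewrite mul0n mul1n => s0 s1.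
  rewrite AhE /= s0 s1.
  (* Shift invariance: moving down one block in [Gam T] is right multiplication by [T^-1 A T]. *)
  have -> : stack (fun t : 'I_l => C *m A ^+ (1 + t) *m T)
      = Gam l *m T *m (invmx T *m A *m T).
    rewrite !mulmxA mulmxK // !stack_mulmx; apply/stackP => t.
    by rewrite exprSr -mulmxE !mulmxA.
  rewrite -(stack_mulmx (fun t : 'I_l => C *m A ^+ (0 + t))) -/(Gam l).
  rewrite mulmxA pseudoinv_row_free_tr ?mul1mx // trmx_mul.
  apply: inj_row_free => v; rewrite mulmxA -(mul0mx _ (Gam l)^T).
  move/(row_free_inj (fGam l (leqnn l))).
  by move/(congr1 (mulmx^~ (invmx T^T))); rewrite mulmxK ?unitmx_tr // mul0mx.
exists T => //; rewrite AhE ChE.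
have obs_hat : observable_in l Ah Ch.
  by rewrite AhE ChE; apply: observable_in_similar.
(* The true data in the coordinates given by [T] fit exactly, so least squares returns them. *)
have vecY : vec Y = upsilon U Ah Ch *m
    col_mx (col_mx (vec (invmx T *m B)) (vec D))
      (stack (fun i => invmx T *m x i 0%N)).
  rewrite upsilonM vec_data_mx; apply/stackP => i; apply/stackP => t.
  by rewrite AhE ChE response_similar // yE.
move: thE; rewrite vecY least_squares ?row_free_upsilon //.
move=> /eq_col_mx[/eq_col_mx[/vec_inj BE /vec_inj ->] /stackP xE].
split=> //.
- by rewrite !mulmxA mulmxV // mul1mx mulmxK.
- by rewrite BE mulKVmx.
- by rewrite mulmxK.
- by move=> i; rewrite xE mulKVmx.
Qed.
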